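(* There exists $N_0 \in \mathbb{N}$ such that for every integer $N \geq N_0$, $$\left|\sum_{1 \leq n < N} \lambda(n)\lambda(N-n)\right| < N-1.$$
   Context: $\lambda$ denotes the Liouville function, $\lambda(n) = (-1)^{\Omega(n)}$, where $\Omega(n)$ is the number of prime factors of $n$ counted with multiplicity. *)

(* Defs.v *)
From mathcomp Require Import all_boot all_order all_algebra.
Set Implicit Arguments.
Unset Strict Implicit.
Unset Printing Implicit Defensive.
Import Order.TTheory GRing.Theory Num.Theory.
Local Open Scope ring_scope.

Definition Omega (n : nat) : nat := (\sum_(p <- primes n) logn p n)%N.

Definition liouville (n : nat) : int := (-1) ^+ Omega n.

(* Main.v *)
Require Import Defs.
From mathcomp Require Import all_boot all_order all_algebra all_solvable all_field.
From mathcomp Require Import zify.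
Import Order.TTheory GRing.Theory Num.Theory.
Local Open Scope ring_scope.

(** If the bound fails at [N], then for some sign [e] we have
    [liouville (N - n) = e * liouville n] for all [0 < n < N]. This reflection
    passes to every divisor of [N] by complete multiplicativity. It fails at
    4, 6, 9, 15 and 25, so for [N >= 11] it remains to refute it at a prime
    [p >= 7].

    At a prime [p] the reflection, together with Dirichlet approximation, makes
    [liouville] multiplicative modulo [p] on [1, p - 1]; hence it is [1] on the
    quadratic residues below [p]. But if [p = 4as + 1] or [p = 4as - 1], then
    Gauss's lemma shows that [a] is a quadratic residue modulo [p]. Taking for
    [a] a prime factor of whichever of [(p - 1)/4], [(p + 1)/4] is an integer
    contradicts [liouville a = -1]. *)

(** * Complete multiplicativity of the Liouville function *)

(** A common summation range for [m], [n] and [m * n] lets [liouvilleM] apply the additivity of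
    [logn] termwise. *)
Lemma Omega_widen (n B : nat) : (0 < n <= B)%N ->
  Omega n = (\sum_(0 <= p < B.+1) logn p n)%N.
Proof.
move=> /andP[n_gt0 n_le]; rewrite /Omega.
rewrite [RHS](bigID (fun p => p \in primes n)) /=.
rewrite [X in (_ + X)%N]big1 ?addn0 => [|p]; last first.
  by rewrite -logn_gt0 lt0n negbK => /eqP.
rewrite -[RHS]big_filter; apply: perm_big; apply: uniq_perm => [||p].
- exact: primes_uniq.
- exact/filter_uniq/iota_uniq.
rewrite mem_filter mem_index_iota leq0n ltnS /=.
case pn: (p \in primes n) => //=; symmetry; apply: leq_trans n_le.
by move: pn; rewrite mem_primes => /and3P[_ _]; apply: dvdn_leq.
Qed.

Lemma liouvilleM (m n : nat) : (0 < m)%N -> (0 < n)%N ->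
  liouville (m * n) = liouville m * liouville n.
Proof.
move=> m_gt0 n_gt0; rewrite /liouville -exprD; congr (_ ^+ _).
rewrite !(@Omega_widen _ (m * n)); [|nia..].
by rewrite -big_split /=; apply: eq_bigr => p _; rewrite lognM.
Qed.

Lemma liouville_prime (p : nat) : prime p -> liouville p = -1.
Proof.
move=> p_pr; rewrite /liouville /Omega primes_prime // big_seq1.
by rewrite logn_prime // eqxx expr1.
Qed.

Lemma liouville_sqr (n : nat) : liouville n * liouville n = 1.
Proof. by rewrite /liouville -expr2 sqrr_sign. Qed.

Lemma liouville_neq0 (n : nat) : liouville n != 0.
Proof. by rewrite signr_eq0. Qed.

Lemma liouville1 : liouville 1 = 1.
Proof. by rewrite /liouville /Omega big_nil. Qed.

(** * The reflection forced by an extremal sum *)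

Definition liouville_reflects (e : int) (N : nat) : Prop :=
  forall n, (0 < n < N)%N -> liouville (N - n)%N = e * liouville n.

Lemma liouville_reflects_dvd (e : int) (N d : nat) :
  (0 < N)%N -> (d %| N)%N -> liouville_reflects e N -> liouville_reflects e d.
Proof.
move=> N_gt0 /dvdnP[k Nkd] reflN n /andP[n_gt0 n_lt].
have k_gt0 : (0 < k)%N by move: N_gt0; rewrite Nkd muln_gt0 => /andP[].
have := reflN (k * n)%N; rewrite Nkd -mulnBr ltn_pmul2l // n_lt muln_gt0 k_gt0 n_gt0.
move=> /(_ isT); rewrite !liouvilleM ?subn_gt0 // mulrCA => kE.
by exact: mulfI (liouville_neq0 k) _ _ kE.
Qed.

(** With [e] the sign of the sum, the [N - 1] terms [1 - e * t n] are nonnegative and add up to at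
    most 0, so each vanishes. *)
Lemma extremal_sum_reflects (N : nat) :
  N%:Z - 1 <= `|\sum_(1 <= n < N) liouville n * liouville (N - n)%N| ->
  (0 < N)%N -> exists e : int, liouville_reflects e N.
Proof.
set S := (\sum_(_ <= _ < _) _) => le_S N_gt0.
pose e : int := if 0 <= S then 1 else -1.
have e2 : e * e = 1 by rewrite /e; case: ifP.
have eS : e * S = `|S|.
  rewrite /e; case: (lerP 0 S) => [S_ge0|S_lt0]; first by rewrite mul1r ger0_norm.
  by rewrite mulN1r ltr0_norm.
pose t n : int := liouville n * liouville (N - n)%N.
have t_ge0 n : 0 <= 1 - e * t n.
  rewrite /t /e /liouville -exprD -signr_odd; case: odd; case: ifP => _;
  by rewrite ?expr1 ?expr0.
have sum_le0 : \sum_(1 <= n < N) (1 - e * t n) <= 0.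
  rewrite sumrB -mulr_sumr eS sumr_const_nat.
  rewrite subr_le0; apply: le_trans le_S.
  by rewrite natrB // natz.
exists e => n n_lt.
have : \sum_(1 <= n < N) (1 - e * t n) == 0 by rewrite eq_le sum_le0 sumr_ge0.
rewrite psumr_eq0 // => /allP/(_ n).
rewrite mem_index_iota n_lt => /(_ isT) /=; rewrite subr_eq0 => /eqP e_t.
rewrite -[RHS]mulr1 [X in _ = _ * X]e_t /t mulrACA.
by rewrite e2 mul1r mulrA liouville_sqr mul1r.
Qed.

(** * Multiplicativity modulo a prime *)

(* Dirichlet approximation of [b / p], by the pigeonhole principle on the [a]
   boxes [floor (a * r / p)] of the residues [r] of [0, b, ..., (a - 1) * b]:
   either two residues share a box, or one with [j > 0] is in the last box. *)
Lemma dirichlet_mod (p a b : nat) : prime p -> (1 < a < p)%N ->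
  exists2 a', (0 < a' < a)%N &
    (a * ((a' * b) %% p) < p)%N \/ (a * (p - (a' * b) %% p) < p)%N.
Proof.
move=> p_pr /andP[a_gt1 a_lt].
have p_gt0 := prime_gt0 p_pr.
(* This makes the bound obtained from the last box strict. *)
have no_eq x : (a * x)%N <> p.
  move=> ax; have : (a %| p)%N by rewrite -ax dvdn_mulr.
  case/primeP: p_pr => _ /(_ a) /[apply]; lia.
pose r j := ((j * b) %% p)%N.
have r_lt j : (r j < p)%N by rewrite ltn_pmod.
have box_lt (j : 'I_a) : ((a * r j) %/ p < a)%N.
  by rewrite ltn_divLR // ltn_pmul2l //; lia.
pose box j := Ordinal (box_lt j).
have [box_inj|] := altP (injectiveP box).
  have last_lt : (a.-1 < a)%N by lia.
  have /codomP[j /(congr1 val) /= jE] := injF_onto box_inj (Ordinal last_lt).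
  exists j; last right.
    rewrite ltn_ord andbT lt0n; apply/eqP => j0.
    by move: jE; rewrite /r j0 mul0n mod0n muln0 div0n; lia.
  have := no_eq (p - r j)%N; have := r_lt j.
  have apE : (a * p = a.-1 * p + p)%N by rewrite -mulSnr prednK // ltnW.
  rewrite -/(r j) mulnBr => _; have := divn_eq (a * r j) p; rewrite -jE.
  by have := ltn_pmod (a * r j) p_gt0; lia.
move=> /injectivePn[j [j' neq_j /(congr1 val) /= eq_box]].
have {neq_j} : (j != j' :> nat) by [].
wlog lt_j : j j' eq_box / (j < j')%N.
  move=> IH neq; case: (ltngtP j j') => [lt|lt|eq]; [exact: (IH j j')| |lia].
  apply: (IH j' j) => //; lia.
move=> _; exists (j' - j)%N; first by have := ltn_ord j'; lia.
have dist : (a * r j < a * r j' + p)%N /\ (a * r j' < a * r j + p)%N.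
  have := divn_eq (a * r j) p; have := divn_eq (a * r j') p; rewrite eq_box.
  have := ltn_pmod (a * r j) p_gt0; have := ltn_pmod (a * r j') p_gt0; lia.
have c_lt := r_lt (j' - j)%N.
have cE : ((r j + r (j' - j)) %% p = r j')%N.
  by rewrite modnDm -mulnDl subnKC // ltnW.
(* Without wrap-around the residue [r (j' - j)] is [r j' - r j]; otherwise its distance to [p] is
   [r j - r j']. Sharing a box keeps both below [p / a]. *)
have [lt_p|ge_p] := ltnP (r j + r (j' - j)%N)%N p.
  left; move: cE; rewrite modn_small // => /(congr1 (muln a)).
  by rewrite mulnDr -/(r _); lia.
right; rewrite -/(r _).
move: cE; rewrite -{1}(subnK ge_p) modnDr modn_small; last by have := r_lt j; lia.
move=> cE; have -> : (p - r (j' - j) = r j - r j')%N by lia.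
by rewrite mulnBr; lia.
Qed.

(** Induction on [a]. Dirichlet gives [a' < a] with [c = (a' * b) %% p] so near 0 or [p] that
    [a * c] modulo [p] is a true product or the reflection of one. Since [a' * (a * b)] is congruent
    to [a * c], the induction hypothesis for [a'], at [b] and at [(a * b) %% p], lets [liouville a']
    be cancelled. *)
Lemma liouville_mod (p : nat) (e : int) (a b : nat) :
  prime p -> liouville_reflects e p -> (0 < a < p)%N -> (0 < b < p)%N ->
  liouville ((a * b) %% p) = liouville a * liouville b.
Proof.
move=> p_pr refl_p; elim/ltn_ind: a b => a IH b /andP[a_gt0 a_lt] b_lt.
have p_gt0 := prime_gt0 p_pr.
have mod_lt x y : (0 < x < p)%N -> (0 < y < p)%N -> (0 < (x * y) %% p < p)%N.
  move=> x_lt y_lt; rewrite ltn_pmod // andbT lt0n -/(dvdn p (x * y)).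
  by rewrite Euclid_dvdM // negb_or !gtnNdvd //; lia.
have [a1|a_gt1] : a = 1%N \/ (1 < a)%N by lia.
  by rewrite a1 mul1n modn_small ?liouville1 ?mul1r //; case/andP: b_lt.
have [|a' a'_lt small] := @dirichlet_mod p a b p_pr; first lia.
set c := ((a' * b) %% p)%N in small.
have a'_ltp : (0 < a' < p)%N by lia.
have c_lt : (0 < c < p)%N by apply: mod_lt.
have cE : liouville c = liouville a' * liouville b by apply: IH; lia.
have acE : liouville ((a * c) %% p) = liouville a * liouville c.
  case: small => [small|small].
    by rewrite modn_small // liouvilleM //; lia.
  have -> : ((a * c) %% p = p - a * (p - c))%N.
    have apE : (a * p = a.-1 * p + p)%N by rewrite -mulSnr prednK // ltnW.
    have ac : (a * c = a.-1 * p + (p - a * (p - c)))%N.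
      have : (a * c <= a * p)%N by rewrite leq_mul2l ltnW ?orbT //; case/andP: c_lt.
      by move: small; rewrite mulnBr; lia.
    by rewrite {1}ac modnMDl modn_small // ltn_subrL p_gt0 muln_gt0 a_gt0; lia.
  have ac_gt0 : (0 < a * (p - c))%N by rewrite muln_gt0 a_gt0; lia.
  (* The sign [e] from reflecting [a * (p - c)] is absorbed in reflecting [p - c] back to [c]. *)
  rewrite refl_p ?ac_gt0 // liouvilleM //; last lia.
  by rewrite mulrCA -refl_p ?subKn; lia.
have : liouville (a' * ((a * b) %% p) %% p) = liouville ((a * c) %% p).
  by congr liouville; rewrite !modnMmr mulnCA.
rewrite IH ?mod_lt ?acE ?cE ?a_gt0 //; last lia.
rewrite mulrCA; apply: mulfI; exact: liouville_neq0.
Qed.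

(** * Quadratic residues and Gauss's lemma *)

Lemma Fp_natr_eq0 (p n : nat) : prime p -> (n%:R == 0 :> 'F_p) = (p %| n)%N.
Proof. by move=> p_pr; rewrite (dvdn_pcharf (pchar_Fp p_pr)). Qed.

(** Write [x = z ^+ i] with [z] of order [2 * m]; then [x ^+ m = 1] forces [i] to be even. *)
Lemma euler_criterion (m : nat) (p := m.*2.+1) (x : 'F_p) :
  prime p -> x ^+ m = 1 -> exists y : 'F_p, x = y * y.
Proof.
move=> p_pr xm1; have m_gt0 : (0 < m)%N by case: (m) @p x p_pr xm1.
pose rs := enum [pred y : 'F_p | y != 0].
have /hasP[z _ z_prim] : has (m.*2).-primitive_root rs.
  apply: has_prim_root; rewrite ?double_gt0 ?enum_uniq //.
    apply/allP => y; rewrite mem_enum inE unity_rootE => y_neq0.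
    rewrite -(inj_eq (mulfI y_neq0)) mulr1 -exprS.
    by rewrite -{2}[y]expf_card card_Fp.
  by rewrite -cardE -[leqRHS]/(#|predC1 (0 : 'F_p)|) cardC1 card_Fp.
have [|[i /= _] xE] := prim_rootP z_prim (x := x).
  by rewrite -mul2n mulnC exprM xm1 expr1n.
have : z ^+ (i * m) == 1 by rewrite exprM -xE xm1.
rewrite -(prim_order_dvd z_prim) -[m.*2]mul2n dvdn_pmul2r // dvdn2 => i_even.
exists (z ^+ i./2); rewrite -exprD addnn xE.
by rewrite -[in LHS](odd_double_half i) (negbTE i_even).
Qed.

(* The usual sign of [a * j], namely whether its residue exceeds [m], is the
   parity of [floor (2 * a * j / p)]. *)
Lemma gauss_lemma (m : nat) (p := m.*2.+1) (a : nat) :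
  prime p -> ~~ (p %| a)%N ->
  (a%:R : 'F_p) ^+ m = \prod_(1 <= j < m.+1) (-1) ^+ ((2 * (a * j)) %/ p).
Proof.
move=> p_pr p_ndvd; have p_gt0 := prime_gt0 p_pr.
pose r j := ((a * j) %% p)%N.
pose h j := if (r j <= m)%N then r j else (p - r j)%N.
have r_lt j : (r j < p)%N by rewrite ltn_pmod.
have r_gt0 j : (0 < j < m.+1)%N -> (0 < r j)%N.
  move=> j_lt; rewrite lt0n -/(dvdn p (a * j)) Euclid_dvdM // negb_or p_ndvd.
  by rewrite gtnNdvd // /p; lia.
have r_inj i j : (0 < i < j)%N -> (j < m.+1)%N -> r i <> r j.
  move=> /andP[i_gt0 lt_ij] j_lt /esym/eqP; rewrite eqn_mod_dvd; last nia.
  by rewrite -mulnBr Euclid_dvdM // (negbTE p_ndvd) gtnNdvd // /p; lia.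
have hE j : (a * j)%:R = (-1) ^+ ((2 * (a * j)) %/ p) * (h j)%:R :> 'F_p.
  have p0 : p%:R = 0 :> 'F_p by apply/eqP; rewrite Fp_natr_eq0.
  rewrite {1 2}(divn_eq (a * j) p) -/(r j) natrD natrM p0 mulr0 add0r.
  rewrite mulnDr mulnA divnMDl // exprD exprM sqrrN !expr1n mul1r.
  rewrite /h; case: leqP => r_m.
    by rewrite divn_small ?mul1r // /p; lia.
  have -> : ((2 * r j) %/ p = 1)%N.
    apply/eqP; rewrite eqn_leq -ltnS ltn_divLR // leq_divRL //.
    by have := r_lt j; rewrite /p in r_m *; lia.
  by rewrite natrB 1?ltnW // p0 sub0r expr1 mulN1r opprK.
(* If [h i = h j], then [r i = r j] or [r i + r j = p]; the latter gives [p %| a * (i + j)],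
   impossible as [0 < i + j < p]. *)
have h_perm : perm_eq [seq h j | j <- index_iota 1 m.+1] (index_iota 1 m.+1).
  have h_uniq : uniq [seq h j | j <- index_iota 1 m.+1].
    rewrite map_inj_in_uniq ?iota_uniq // => i j.
    rewrite !mem_index_iota => i_lt j_lt hij.
    have [] : r i = r j \/ (r i + r j = p)%N.
    - have := r_lt i; have := r_lt j; move: hij.
      by rewrite /h; case: (leqP (r i) m); case: (leqP (r j) m); lia.
    - move=> rij; case: (ltngtP i j) => // lt_ij; exfalso;
        [apply: (r_inj i j)|apply: (r_inj j i)]; lia.
    move=> rij; have : (p %| a * (i + j))%N.
      by rewrite mulnDr /dvdn -modnDm -/(r i) -/(r j) rij modnn.
    by rewrite Euclid_dvdM // (negbTE p_ndvd) gtnNdvd // /p; lia.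
  apply: uniq_perm; rewrite ?iota_uniq //.
  apply: (uniq_min_size h_uniq _ _).2; last by rewrite size_map.
  move=> _ /mapP[j j_lt ->]; move: j_lt; rewrite !mem_index_iota => j_lt.
  by have := r_gt0 _ j_lt; have := r_lt j; rewrite /h /p; case: (leqP (r j) m); lia.
have fact_neq0 : \prod_(1 <= j < m.+1) (j%:R : 'F_p) != 0.
  rewrite prodf_seq_neq0; apply/allP => j; rewrite mem_index_iota => j_lt /=.
  by rewrite Fp_natr_eq0 // gtnNdvd // /p; lia.
have h_prod : \prod_(1 <= j < m.+1) ((h j)%:R : 'F_p) = \prod_(1 <= j < m.+1) j%:R.
  by rewrite -[RHS](perm_big _ h_perm) big_map.
apply: (mulIf fact_neq0); rewrite -[in RHS]h_prod -big_split /=.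
under [RHS]eq_bigr => j _ do rewrite -hE natrM.
by rewrite big_split /= prodr_const_nat subn1.
Qed.

(** The indices [2 * k] and [2 * k + 1] have the same quotient by the even number [2 * s], so their
    signs multiply to 1. *)
Lemma block_parity (R : pzRingType) (s n : nat) :
  \prod_(0 <= k < n.*2) ((-1) ^+ (k %/ s.*2)) = 1 :> R.
Proof.
elim: n => [|n IH]; first by rewrite big_nil.
rewrite doubleS !big_nat_recr //= IH mul1r -exprD.
have -> : (n.*2.+1 %/ s.*2 = n.*2 %/ s.*2)%N.
  by rewrite -[s.*2]mul2n !divnMA !divn2 /= uphalf_double doubleK.
by rewrite addnn -mul2n exprM sqrrN expr1n expr1n.
Qed.

(* The floors in Gauss's lemma are constant on consecutive blocks of the even
   length [2 * s], so the signs cancel. *)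
Lemma divisor_pow_half (m a s : nat) (p := m.*2.+1) :
  prime p -> m = (a * s).*2 \/ m.+1 = (a * s).*2 -> (a%:R : 'F_p) ^+ m = 1.
Proof.
move=> p_pr mE; have p_gt1 := prime_gt1 p_pr.
have as_gt0 : (0 < a * s)%N by move: p_gt1; rewrite /p; lia.
have [a_gt0 s_gt0] : (0 < a)%N /\ (0 < s)%N by apply/andP; rewrite -muln_gt0.
have a_lt : (a < p)%N by rewrite /p; nia.
rewrite gauss_lemma ?gtnNdvd // -/p -[RHS](block_parity _ s (a * s)).
(* If [p = 4as + 1], shift to [j = k + 1]; if [p = 4as - 1], adjoin [j = 0], whose sign is 1. Either
   way the floor at [k] is [k %/ s.*2]. *)
case: mE => mE.
  rewrite -mE [LHS]big_add1 /=; apply: eq_big_nat => k k_lt; congr (_ ^+ _).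
  have div_lt : (k %/ s.*2 < a)%N by rewrite ltn_divLR ?double_gt0 //; lia.
  have mod_lt : (k %% s.*2 < s.*2)%N by rewrite ltn_pmod ?double_gt0.
  rewrite {1}(divn_eq k s.*2); move: (k %/ s.*2)%N (k %% s.*2)%N div_lt mod_lt => i l.
  move=> i_lt l_lt.
  have -> : (2 * (a * (i * s.*2 + l).+1) = i * p + (2 * (a * l.+1) - i))%N.
    by rewrite /p mE; nia.
  by rewrite divnMDl ?divn_small ?addn0 // /p ?mE; nia.
rewrite -mE [RHS]big_nat_recl // div0n expr0 mul1r [LHS]big_add1 /=.
apply: eq_big_nat => k k_lt; congr (_ ^+ _).
have : (k.+1 < a * s.*2)%N by lia.
move: k.+1 => {k k_lt} k k_lt.
have div_lt : (k %/ s.*2 < a)%N by rewrite ltn_divLR ?double_gt0.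
have mod_lt : (k %% s.*2 < s.*2)%N by rewrite ltn_pmod ?double_gt0.
rewrite {1}(divn_eq k s.*2); move: (k %/ s.*2)%N (k %% s.*2)%N div_lt mod_lt => i l.
move=> i_lt l_lt.
have pE : (p + 1 = 4 * (a * s))%N by rewrite /p; lia.
have -> : (2 * (a * (i * s.*2 + l)) = i * p + (2 * (a * l) + i))%N by nia.
by rewrite divnMDl ?divn_small ?addn0 //; nia.
Qed.

(** * Refutation at primes and at small divisors *)

Lemma no_reflecting_prime (p : nat) (e : int) :
  prime p -> (7 <= p)%N -> ~ liouville_reflects e p.
Proof.
move=> p_pr p_ge7 refl_p.
have [m pE] : exists m, p = m.*2.+1.
  exists p./2; rewrite -[LHS]odd_double_half.
  by case: (even_prime p_pr) => [p2|->]; first by rewrite p2 in p_ge7.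
(* [t] is [(p - 1) / 4] or [(p + 1) / 4]; it exceeds 1 because [p >= 7], so it has a prime
   factor. *)
have [t t_gt1 mE] : exists2 t, (1 < t)%N & m = t.*2 \/ m.+1 = t.*2.
  by exists (uphalf m); have := odd_double_half m; rewrite uphalf_half; case: odd; lia.
have q_pr := pdiv_prime t_gt1; set q := pdiv t in q_pr.
have tE : t = (q * (t %/ q))%N by rewrite mulnC divnK ?pdiv_dvd.
have q_lt : (q < p)%N by have := pdiv_leq (ltnW t_gt1); rewrite -/q; lia.
rewrite tE in mE; rewrite {}pE in p_pr refl_p q_lt.
have [y qE] := euler_criterion _ _ p_pr (divisor_pow_half _ _ _ p_pr mE).
have valE : (((y : nat) * y) %% m.*2.+1 = q)%N.
  have : ((y : nat) * y)%:R = q%:R :> 'F_(m.*2.+1) by rewrite natrM natr_Zp qE.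
  by move/(congr1 (@nat_of_ord _)); rewrite !val_Fp_nat // (modn_small q_lt).
have y_lt : (0 < (y : nat) < m.*2.+1)%N.
  apply/andP; split; last by have := ltn_ord y; rewrite [X in (_ < X)%N -> _]Fp_cast.
  rewrite lt0n; apply/eqP => y0; move: valE; rewrite y0 mod0n => q0.
  by move: q_pr; rewrite -q0.
have := liouville_mod _ _ _ _ p_pr refl_p y_lt y_lt.
by rewrite valE liouville_sqr liouville_prime.
Qed.

Lemma no_reflecting_small (e : int) (N : nat) :
  N \in [:: 4; 6; 9; 15; 25]%N -> ~ liouville_reflects e N.
Proof.
have test (n1 n2 M : nat) : (0 < n1 < M)%N -> (0 < n2 < M)%N ->
    liouville (M - n1)%N * liouville n1 != liouville (M - n2)%N * liouville n2 ->
    ~ liouville_reflects e M.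
  move=> lt1 lt2 + reflM.
  by rewrite reflM // reflM // -!mulrA !liouville_sqr eqxx.
(* In terms of [prime_decomp] the values are found by computation. *)
have L n : liouville n = (-1) ^+ sumn [seq pf.2 | pf <- prime_decomp n].
  rewrite /liouville /Omega; congr (_ ^+ _).
  rewrite sumnE big_map (prime_decompE n) big_map //.
rewrite !inE => /or4P[/eqP->|/eqP->|/eqP->|/orP[]/eqP->].
- by apply: (test 1%N 2%N); rewrite // !L.
- by apply: (test 1%N 3%N); rewrite // !L.
- by apply: (test 1%N 2%N); rewrite // !L.
- by apply: (test 1%N 4%N); rewrite // !L.
- by apply: (test 1%N 3%N); rewrite // !L.
Qed.

(** Otherwise all prime factors are 2, 3 or 5. A product of two of them is in the list unless it is
    10, and then a third factor 2, 3 or 5 yields the divisor 4, 6 or 25. *)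
Lemma prime_ge7_or_small_divisor (N : nat) : (11 <= N)%N ->
  exists2 d, (d %| N)%N &
    (prime d && (7 <= d)%N) || (d \in [:: 4; 6; 9; 15; 25]%N).
Proof.
move=> N_ge; set goal := (exists2 d, _ & _).
have pdiv_case n : (1 < n)%N -> (n %| N)%N ->
    goal \/ exists2 q, (q \in [:: 2; 3; 5]%N) & exists k, n = (k * q)%N.
  move=> n_gt1 nN; have q_pr := pdiv_prime n_gt1.
  have [q_ge7|q_lt7] := leqP 7 (pdiv n).
    by left; exists (pdiv n); rewrite ?q_pr ?q_ge7 // (dvdn_trans (pdiv_dvd n)).
  right; exists (pdiv n); last by apply/dvdnP/pdiv_dvd.
  by move: (pdiv n) q_pr q_lt7 => [|[|[|[|[|[|[|]]]]]]].
have [||//|[q q_in [k NE]]] := pdiv_case N; [lia|exact: dvdnn|].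
have [|||[q' q'_in [k' kE]]] := pdiv_case k => //.
- by move: q_in; rewrite !inE => /or3P[]/eqP qE; lia.
- by rewrite NE dvdn_mulr.
have small d k0 : N = (k0 * d)%N -> d \in [:: 4; 6; 9; 15; 25]%N -> goal.
  by move=> NE' d_in; rewrite /goal NE'; exists d; rewrite ?dvdn_mull // d_in orbT.
have [qq|] := boolP ((q' * q)%N \in [:: 4; 6; 9; 15; 25]%N).
  by apply: (small _ k') qq; rewrite NE kE mulnA.
move=> qq; have {}qq : (q' * q = 10)%N.
  by move: q_in q'_in qq; rewrite !inE => /or3P[]/eqP-> /or3P[]/eqP->.
have {}NE : N = (k' * 10)%N by rewrite NE kE -qq mulnA.
have [|||[r r_in [l k'E]]] := pdiv_case k' => //; first lia.
  by rewrite NE dvdn_mulr.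
move: r_in; rewrite !inE => /or3P[]/eqP rE; rewrite rE in k'E.
- by apply: (small 4%N (l * 5)%N) => //; lia.
- by apply: (small 6%N (l * 5)%N) => //; lia.
- by apply: (small 25%N (l * 2)%N) => //; lia.
Qed.

Theorem theorem1p2 :
  exists N0 : nat, forall N : nat, (N0 <= N)%N ->
    `|\sum_(1 <= n < N) liouville n * liouville (N - n)%N| < N%:Z - 1.
Proof.
(* This is the least possible value: for [N = 10] all nine products equal 1. *)
exists 11%N => N N_ge; have N_gt0 : (0 < N)%N by lia.
rewrite ltNge; apply/negP => /extremal_sum_reflects /(_ N_gt0)[e reflN].
have [d dN bad] := prime_ge7_or_small_divisor _ N_ge.
have refl_d := liouville_reflects_dvd _ _ _ N_gt0 dN reflN.
case/orP: bad => [/andP[d_pr d_ge7]|d_in].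
- exact: no_reflecting_prime refl_d.
- exact: no_reflecting_small refl_d.
Qed.
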